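(* Let $\Theta=\mathbb{R}^n$, let $(\ell_t)_{t\ge0}$ be smooth functions $\ell_t:\Theta\to\mathbb{R}$, and let $(f(t))_{t\ge 0}$ and $(\mu_t)_{t\ge 0}$ be fixed sequences of nonzero real numbers. Let $(\theta_t)_{t\ge0}$ and $\boldsymbol{\eta}=(\eta_t)_{t\ge0}$ be the sequences of parameters and step sizes produced by the SG/SG algorithm without Hessian approximation, that is: $\theta_0\in\Theta$ and $\eta_0>0$ are arbitrary, $h_0=0\in\mathbb{R}^n$, and for all $t\ge0$ $$\begin{aligned}\log\eta_{t+1}&=\log\eta_t+\frac{1}{\mu_t}\,\partial_\theta\ell_t(\theta_t)\cdot h_t,\\ h_{t+1}&=h_t+\frac{\eta_{t+1}}{f(t)}\,\partial_\theta\ell_t(\theta_t)+\frac{\eta_{t+1}}{f(t)}\,\partial_\theta^2\ell_t(\theta_t)\cdot h_t,\\ \theta_{t+1}&=\theta_t+\frac{\eta_{t+1}}{f(t)}\,\partial_\theta\ell_t(\theta_t).\end{aligned}$$ Let $e$ be the tangent vector to $\log(\mathcal{S})$ at $\log(\boldsymbol{\eta})$ with coordinates $e_t=1$ for all $t\ge 0$. Then, for all $t\ge0$, $$\log\eta_{t+1}=\log\eta_t+\frac{1}{\mu_t}\,\frac{\partial}{\partial e}\,\ell_t(T_t(\boldsymbol{\eta})).$$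
   Context: $\partial_\theta\ell_t(\theta)\in\mathbb{R}^n$ is the Euclidean gradient of $\ell_t$, $\partial_\theta\ell_t(\theta)\cdot h$ is its inner product with $h\in\mathbb{R}^n$, and $\partial_\theta^2\ell_t(\theta)\cdot h$ is the Hessian of $\ell_t$ at $\theta$ applied to $h$. $\mathcal{S}$ is the space of infinite sequences $\boldsymbol{\eta}=(\eta_0,\eta_1,\eta_2,\dots)$ of positive reals, and $\log(\mathcal{S})$ is its image under $\boldsymbol{\eta}\mapsto\log(\boldsymbol{\eta})=(\log\eta_t)_{t\ge0}$ (i.e. the space of all real sequences). With the fixed initial value $\theta_0$, the maps $T_t:\mathcal{S}\to\Theta$ are defined, for an arbitrary sequence $\boldsymbol{\eta}\in\mathcal{S}$, by $T_0(\boldsymbol{\eta})=\theta_0$ and $$T_{t+1}(\boldsymbol{\eta})=T_t(\boldsymbol{\eta})+\frac{\eta_{t+1}}{f(t)}\,\partial_\theta\ell_t(T_t(\boldsymbol{\eta})).$$ $T_t$ depends only on $\eta_0,\dots,\eta_t$. Functions on $\mathcal{S}$ are differentiated in the logarithmic coordinates: for a function $g$ on $\mathcal{S}$ depending on finitely many coordinates and a tangent vector $e=(e_j)_{j\ge0}$ to $\log(\mathcal{S})$ at $\log(\boldsymbol{\eta})$ (a real sequence), $$\frac{\partial}{\partial e}g(\boldsymbol{\eta})=\frac{d}{ds}\Big|_{s=0}g\big((\eta_j e^{s e_j})_{j\ge0}\big),$$ where in $e^{s e_j}$ the base is the exponential function. In the claim this derivative is taken with $T_t$ viewed as a function of a free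 sequence, and then evaluated at the sequence $\boldsymbol{\eta}$ generated by the algorithm. (The paper uses throughout $f(t)=\sqrt{t+2}\,\log(t+3)$, and $\mu_t$ is some learning rate on $\log\eta$, such as $\mu_t=\sqrt{t+2}\,\log(t+3)$.) *)

(* Defs.v *)
From HB Require Import structures.
From mathcomp Require Import all_boot all_order all_algebra.
From mathcomp Require Import all_classical all_reals all_analysis.

Set Implicit Arguments.
Unset Strict Implicit.
Unset Printing Implicit Defensive.
Import Order.TTheory GRing.Theory Num.Theory.
Import numFieldNormedType.Exports.

Local Open Scope ring_scope.

Section EuclideanCalculus.
Context {R : realType} {n : nat}.
Implicit Types (g : 'cV[R]_n -> R) (x u v : 'cV[R]_n).

Definition partial (i : 'I_n) g : 'cV[R]_n -> R := 'D_(delta_mx i 0) g.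

Definition iter_partial (s : seq 'I_n) g : 'cV[R]_n -> R := foldr partial g s.

(* C^oo: the partial derivatives of all orders exist and are continuous;
   s = [::] gives g itself.  Existence is stated separately because 'D_v g is
   a total operator with a default value. *)
Definition smooth g : Prop :=
  forall s : seq 'I_n,
    continuous (iter_partial s g) /\
    forall x (i : 'I_n), derivable (iter_partial s g) x (delta_mx i 0).

Definition gradient g x : 'cV[R]_n := \col_i partial i g x.

(* Jacobian of the gradient: row i is the gradient of partial i g *)
Definition hessian g x : 'M[R]_n :=
  \matrix_(i, j) partial j (partial i g) x.

Definition dot u v : R := \sum_i u i 0 * v i 0.

End EuclideanCalculus.

Section StepSizes.
Context {R : realType}.

Definition stepseq : Type := nat -> {posnum R}.

(* the point (eta_j * exp(s e_j))_j, i.e. log(eta) + s e in logarithmic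
   coordinates *)
Definition log_shift (eta : stepseq) (e : nat -> R) (s : R) : stepseq :=
  fun j => PosNum (mulr_gt0 [gt0 of (eta j)%:num] (expR_gt0 (s * e j))).

Definition log_derivable (g : stepseq -> R) (eta : stepseq) (e : nat -> R)
    : Prop :=
  derivable (fun s : R => g (log_shift eta e s)) 0 1.

(* derive1 is total: the value is d/ds at s = 0 only under
   log_derivable g eta e *)
Definition log_derive (g : stepseq -> R) (eta : stepseq) (e : nat -> R) : R :=
  derive1 (fun s : R => g (log_shift eta e s)) 0.

(* the map T_t, for a free sequence eta *)
Fixpoint sg_iter {n : nat} (f : nat -> R) (l : nat -> 'cV[R]_n -> R)
    (theta0 : 'cV[R]_n) (t : nat) (eta : stepseq) : 'cV[R]_n :=
  if t is t'.+1 then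
    let x := sg_iter f l theta0 t' eta in
    x + ((eta t'.+1)%:num / f t') *: gradient (l t') x
  else theta0.

End StepSizes.
Arguments stepseq : clear implicits.

(* Main.v *)
(* Differentiating the recursion for T_t along s |-> (eta_j exp(s e_j))_j at
   s = 0 gives, by the chain rule, exactly the recursion defining h_t, because
   the derivative of eta_{t+1} exp(s) at 0 is eta_{t+1}; so h_t is the derivative
   of T_t along e = (1, 1, ...).  The claim is then the chain rule for
   l_t o T_t.

   Smoothness is given through continuous partial derivatives, so the chain rule
   is proved from the coordinatewise mean value theorem. *)
Require Import Defs.
From mathcomp Require Import all_boot all_order all_algebra.
From mathcomp Require Import all_classical all_reals all_analysis.

Import Order.TTheory GRing.Theory Num.Theory.
Import numFieldNormedType.Exports.

Local Open Scope ring_scope.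
Local Open Scope classical_set_scope.

Lemma cvg_mx {R : realFieldType} {T : Type} {F : set_system T} {FF : Filter F}
    {m n : nat} (M : T -> 'M[R]_(m, n)) (L : 'M[R]_(m, n)) :
  (forall i j, M x i j @[x --> F] --> L i j) -> M @ F --> L.
Proof.
move=> ML; apply/cvgrPdist_le => e e0; near=> x.
rewrite /Num.Def.normr/= mx_normrE (bigmax_le _ (ltW e0))//= => i _.
rewrite !mxE; move: i; near: x; apply: filter_forall => i.
exact: ((cvgrPdist_le _ _).1 (ML i.1 i.2)).
Unshelve. all: by end_near. Qed.

Lemma is_derive_mxP {R : realFieldType} {V : normedModType R} {m n : nat}
    (M : V -> 'M[R]_(m, n)) (x v : V) (dM : 'M[R]_(m, n)) :
  is_derive x v M dM <-> forall i j, is_derive x v (fun y => M y i j) (dM i j).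
Proof.
split=> [[dMx <-] i j|dMx].
  have /derivable_mxP dMij := dMx.
  by apply: DeriveDef => //; rewrite derive_mx// mxE.
have derM : derivable M x v by apply/derivable_mxP => i j; have [] := dMx i j.
apply: DeriveDef => //; rewrite derive_mx//; apply/matrixP => i j.
by rewrite mxE; have [] := dMx i j.
Qed.

Section Partials.
Context {R : realType} {n : nat}.
Implicit Types (g : 'cV[R]_n -> R) (x y : 'cV[R]_n).

(** The two difference quotients are the same function of the increment. A partial derivative thus
    becomes the derivative of a real function, to which the mean value theorem applies. *)
Lemma is_derive_line g x (i : 'I_n) (s : R) :
  derivable g (x + s *: delta_mx i 0) (delta_mx i 0) ->
  is_derive s (1 : R) (fun t : R => g (x + t *: delta_mx i 0))
    (partial i g (x + s *: delta_mx i 0)).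
Proof.
move=> dg.
have E : (fun h : R => h^-1 *: (((fun t : R => g (x + t *: delta_mx i 0))
             \o shift s) (h *: (1 : R)) - g (x + s *: delta_mx i 0))) =
    (fun h : R => h^-1 *: ((g \o shift (x + s *: delta_mx i 0))
             (h *: delta_mx i 0) - g (x + s *: delta_mx i 0))).
  apply/funext => h /=; congr (_ *: (g _ - _)).
  by rewrite [h%:A]mulr1 scalerDl addrCA.
by apply: DeriveDef; rewrite /derivable /partial /derive E.
Qed.

(** The sign of [a] is free, so the intermediate point is located by [|s| <= |a|], the form that
    later forces such points to converge. For [a < 0] the mean value theorem is used on [[a, 0]] and
    the two sign changes cancel. *)
Lemma partial_MVT g (i : 'I_n) x (a : R) :
  (forall y, derivable g y (delta_mx i 0)) ->
  exists2 s : R, `|s| <= `|a| &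
    g (x + a *: delta_mx i 0) - g x
    = partial i g (x + s *: delta_mx i 0) * a.
Proof.
move=> dg; pose phi (t : R) := g (x + t *: delta_mx i 0).
pose dphi (t : R) := partial i g (x + t *: delta_mx i 0).
have dphiP (t : R) : is_derive t (1 : R) phi (dphi t) by exact: is_derive_line.
have phic (b c : R) : {within `[b, c], continuous phi}.
  by apply: derivable_within_continuous => t _; have [] := dphiP t.
have phi0 : phi 0 = g x by rewrite /phi scale0r addr0.
rewrite -phi0 -/(phi a).
have [a0|a0] := leP 0 a.
  have [s + ->] := MVT_segment a0 (fun t _ => dphiP t) (phic _ _).
  rewrite in_itv/= subr0 => /andP[s0 sa]; exists s => //.
  by rewrite !ger0_norm.
have [s + E] := MVT_segment (ltW a0) (fun t _ => dphiP t) (phic _ _).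
rewrite in_itv/= => /andP[sa s0]; exists s.
  by rewrite !ler0_norm ?lerN2// ltW.
by rewrite -[LHS]opprB E sub0r mulrN opprK.
Qed.

(* The increment is telescoped along the path from x to y that changes one
   coordinate at a time; w k has its first k coordinates already moved. *)
Lemma increment_partials g x y :
  (forall z (i : 'I_n), derivable g z (delta_mx i 0)) ->
  exists2 xi : 'I_n -> 'cV[R]_n,
    forall k i, `|xi k i 0 - x i 0| <= `|y i 0 - x i 0| &
    g y - g x = \sum_k partial k g (xi k) * (y k 0 - x k 0).
Proof.
move=> dg; pose w (k : nat) : 'cV[R]_n :=
  \col_i if (i < k)%N then y i 0 else x i 0.
have wS (k : 'I_n) : w k.+1 = w k + (y k 0 - x k 0) *: delta_mx k 0.
  apply/colP => i; rewrite !mxE eqxx andbT ltnS.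
  have [->|ik] := eqVneq i k; first by rewrite leqnn ltnn mulr1 subrKC.
  by rewrite mulr0 addr0 leq_eqVlt (negbTE (ik : val i != val k)).
have /choice[s sP] (k : 'I_n) : exists s : R, `|s| <= `|y k 0 - x k 0| /\
    g (w k.+1) - g (w k)
    = partial k g (w k + s *: delta_mx k 0) * (y k 0 - x k 0).
  rewrite wS; have [s s1 s2] := @partial_MVT g k (w k) (y k 0 - x k 0) (dg^~ k).
  by exists s.
exists (fun k : 'I_n => w k + s k *: delta_mx k 0) => [k i|].
  rewrite !mxE eqxx andbT.
  (* Coordinate [k] of [w k] has not moved yet, so there the offset is [s k]; any other coordinate
     is that of [y] or that of [x]. *)
  have [->|ik] := eqVneq i k.
    by rewrite ltnn mulr1 addrAC subrr add0r; have [] := sP k.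
  by rewrite mulr0 addr0; case: ifP => // _; rewrite subrr normr0.
have wn : w n = y by apply/colP => i; rewrite mxE ltn_ord.
have w0 : w 0%N = x by apply/colP => i; rewrite mxE.
rewrite -[in g y]wn -[in g x]w0.
rewrite -(telescope_sumr (fun k => g (w k)) (leq0n n)) big_mkord.
by apply: eq_bigr => k _; have [_ ->] := sP k.
Qed.

(** The difference quotient of [g \o c] is a finite sum of partials at intermediate points times
    coordinate quotients of [c]. The points tend to [c s], where the partials are continuous, so
    each product converges. *)
Lemma is_derive_comp_partials g (c : R -> 'cV[R]_n) (s : R) (v : 'cV[R]_n) :
  (forall z (i : 'I_n), derivable g z (delta_mx i 0)) ->
  (forall i, {for c s, continuous (partial i g)}) ->
  is_derive s (1 : R) c v ->
  is_derive s (1 : R) (g \o c) (dot (gradient g (c s)) v).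
Proof.
move=> dg cg dc.
have /choice[xi xiP] (r : R) : exists xi : 'I_n -> 'cV[R]_n,
    (forall k i, `|xi k i 0 - c s i 0| <= `|c r i 0 - c s i 0|) /\
    g (c r) - g (c s) = \sum_k partial k g (xi k) * (c r k 0 - c s k 0).
  by have [xi ? ?] := increment_partials g (c s) (c r) dg; exists xi.
have shiftc : h *: (1 : R) + s @[h --> (0 : R)^'] --> s.
  have {2}<- : 0 *: (1 : R) + s = s by rewrite scale0r add0r.
  apply: cvg_within_filter.
  by apply: cvgD; [apply: cvgZ; [exact: cvg_id|]|]; exact: cvg_cst.
have cc : {for s, continuous c}.
  by have [/derivable1_diffP/differentiable_continuous] := dc.
have cic k : c (h *: (1 : R) + s) k 0 @[h --> (0 : R)^'] --> c s k 0.
  have ccs := cvg_comp _ _ shiftc cc.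
  exact: (cvg_comp _ _ ccs (@coord_continuous _ _ _ k 0 (c s))).
(* Squeeze: coordinatewise, the intermediate points are no farther from [c s] than the curve itself,
   which is continuous at [s]. *)
have xic k : xi (h *: (1 : R) + s) k @[h --> (0 : R)^'] --> c s.
  apply: cvg_mx => i j; rewrite ord1.
  apply/cvgrPdist_le => e e0; near=> h.
  rewrite distrC (le_trans ((xiP _).1 k i))// distrC.
  by near: h; move/cvgrPdist_le : (cic i); exact.
have quot k : h^-1 * (c (h *: (1 : R) + s) k 0 - c s k 0) @[h --> (0 : R)^']
    --> v k 0.
  have /is_derive_mxP/(_ k 0)[+ <-] := dc.
  by move=> dk; exact: dk.
suff L : h^-1 *: ((g \o c \o shift s) (h *: (1 : R)) - (g \o c) s) @[h --> (0 : R)^']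
    --> dot (gradient g (c s)) v.
  by apply: DeriveDef; [apply/cvg_ex; eexists; exact: L|exact: cvg_lim L].
have -> : (fun h : R => h^-1 *: ((g \o c \o shift s) (h *: (1 : R)) - (g \o c) s))
  = fun h : R => \sum_k partial k g (xi (h *: (1 : R) + s) k)
      * (h^-1 * (c (h *: (1 : R) + s) k 0 - c s k 0)).
  apply/funext => h /=; rewrite (xiP _).2 scaler_sumr; apply: eq_bigr => k _.
  by rewrite mulrCA.
rewrite /dot; apply: cvg_big => [|k _]; first exact: add_continuous.
rewrite mxE; apply: cvgM; last exact: quot.
exact: (cvg_comp _ _ (xic k) (cg k)).
Unshelve. all: by end_near. Qed.
End Partials.

Section SGSG.
Context {R : realType} {n : nat}.

Lemma smooth_partial (g : 'cV[R]_n -> R) (i : 'I_n) :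
  smooth g -> smooth (partial i g).
Proof.
(* Appending [i] to the multi-index makes [partial i] the innermost derivative. *)
by move=> gs s; have := gs (rcons s i); rewrite /iter_partial foldr_rcons.
Qed.

Lemma is_derive_comp_smooth (g : 'cV[R]_n -> R) (c : R -> 'cV[R]_n) (s : R)
    (v : 'cV[R]_n) :
  smooth g -> is_derive s (1 : R) c v ->
  is_derive s (1 : R) (g \o c) (dot (gradient g (c s)) v).
Proof.
move=> gs; apply: is_derive_comp_partials => [z i|i].
  exact: (gs [::]).2.
exact: (smooth_partial g i gs [::]).1.
Qed.

(** Row [i] of the Hessian is the gradient of [partial i g], which is again smooth, so the chain
    rule applies entry by entry. *)
Lemma is_derive_gradient_comp (g : 'cV[R]_n -> R) (c : R -> 'cV[R]_n) (s : R)
    (v : 'cV[R]_n) :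
  smooth g -> is_derive s (1 : R) c v ->
  is_derive s (1 : R) (fun r => gradient g (c r)) (hessian g (c s) *m v).
Proof.
move=> gs dc; apply/is_derive_mxP => i j; rewrite ord1.
have := is_derive_comp_smooth _ _ _ _ (smooth_partial g i gs) dc.
have -> : partial i g \o c = (fun r => gradient g (c r) i 0).
  by apply/funext => r; rewrite mxE.
congr is_derive; rewrite mxE /dot.
by apply: eq_bigr => k _; rewrite !mxE.
Qed.

Lemma log_shift0 (eta : stepseq R) (e : nat -> R) : log_shift eta e 0 = eta.
Proof.
by apply/funext => j; apply/val_inj; rewrite /= mul0r expR0 mulr1.
Qed.

Lemma is_derive_log_shift (eta : stepseq R) (e : nat -> R) (j : nat) :
  is_derive 0 (1 : R) (fun s => (log_shift eta e s j)%:num)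
    ((eta j)%:num * e j).
Proof.
have dlin : is_derive (0 : R) (1 : R) (fun s => s * e j) (e j).
  have := is_deriveM (is_derive_id (0 : R) (1 : R))
    (is_derive_cst (e j) (0 : R) (1 : R)).
  by rewrite scaler0 add0r /cst /= [_%:A]mulr1.
have := is_deriveZ (eta j)%:num (is_derive1_comp (is_derive_expR _) dlin).
by rewrite mul0r expR0 mul1r.
Qed.

(** For a general direction, [e t.+1] enters only where the step size is differentiated. The
    induction carries the value together with the derivative, since the chain rule evaluates
    gradient and Hessian at the iterate and the recursion for [h] at [theta t]. *)
Lemma is_derive_sg_iter (f : nat -> R) (l : nat -> 'cV[R]_n -> R)
    (eta : stepseq R) (h theta : nat -> 'cV[R]_n) (e : nat -> R) :
  (forall t, smooth (l t)) -> h 0%N = 0 ->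
  (forall t, h t.+1 =
     h t + ((eta t.+1)%:num / f t * e t.+1) *: gradient (l t) (theta t)
         + ((eta t.+1)%:num / f t) *: (hessian (l t) (theta t) *m h t)) ->
  (forall t, theta t.+1 =
     theta t + ((eta t.+1)%:num / f t) *: gradient (l t) (theta t)) ->
  forall t, sg_iter f l (theta 0%N) t eta = theta t /\
    is_derive 0 (1 : R)
      (fun s => sg_iter f l (theta 0%N) t (log_shift eta e s)) (h t).
Proof.
move=> ls h0 hS thetaS; elim=> [|t [IH dIH]].
  by split=> //=; rewrite h0; exact: is_derive_cst.
split; first by rewrite /= IH thetaS.
rewrite hS -addrA; apply: is_deriveD.
set c := (fun s : R => sg_iter _ _ _ t _) in dIH *.
have c0 : c 0 = theta t by rewrite /c log_shift0.
have /is_derive_mxP dgr := is_derive_gradient_comp _ _ _ _ (ls t) dIH.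
apply/is_derive_mxP => i j.
(* Product rule: differentiating the gradient entry gives the Hessian term, differentiating the step
   size gives the gradient term. *)
have := is_deriveM (is_deriveZ (f t)^-1 (is_derive_log_shift eta e t.+1)) (dgr i j).
congr is_derive.
  by apply/funext => s; rewrite [RHS]mxE [_ / _]mulrC.
rewrite c0 /= mul0r expR0 mulr1 !mxE addrC /GRing.scale/=.
by rewrite [in RHS](mulrC _ (f t)^-1) [X in _ + X = _]mulrC !mulrA.
Qed.
End SGSG.

Theorem proposition1 (R : realType) (n : nat) (l : nat -> 'cV[R]_n -> R)
  (l_smooth : forall t, smooth (l t))
  (f mu : nat -> R) (f_neq0 : forall t, f t != 0) (mu_neq0 : forall t, mu t != 0)
  (eta : stepseq R) (h theta : nat -> 'cV[R]_n)
  (h0 : h 0%N = 0)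
  (etaS : forall t, ln (eta t.+1)%:num =
     ln (eta t)%:num + 1 / mu t * dot (gradient (l t) (theta t)) (h t))
  (hS : forall t, h t.+1 =
     h t + ((eta t.+1)%:num / f t) *: gradient (l t) (theta t)
         + ((eta t.+1)%:num / f t) *: (hessian (l t) (theta t) *m h t))
  (thetaS : forall t, theta t.+1 =
     theta t + ((eta t.+1)%:num / f t) *: gradient (l t) (theta t))
  (e : nat -> R) (e1 : forall t, e t = 1) (t : nat) :
  let lT (z : stepseq R) := l t (sg_iter f l (theta 0%N) t z) in
  log_derivable lT eta e /\
  ln (eta t.+1)%:num = ln (eta t)%:num + 1 / mu t * log_derive lT eta e.
Proof.
move=> lT.
pose c s := sg_iter f l (theta 0%N) t (log_shift eta e s).
have hS' k : h k.+1 =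
     h k + ((eta k.+1)%:num / f k * e k.+1) *: gradient (l k) (theta k)
         + ((eta k.+1)%:num / f k) *: (hessian (l k) (theta k) *m h k).
  by rewrite e1 mulr1.
have [iterE dc] := is_derive_sg_iter f l eta h theta e l_smooth h0 hS' thetaS t.
have [dlc lcE] := is_derive_comp_smooth _ _ _ _ (l_smooth t) dc.
(* The chain rule gives the derivative at the iterate for the shift by 0, which is [eta] itself,
   hence at [theta t]; what remains is the update of [eta]. *)
split=> //; rewrite /log_derive derive1E [X in _ * X]lcE log_shift0 iterE.
exact: etaS.
Qed.
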